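(* The marginal flow-matching objective $$\mathcal{L}_{\mathrm{FM}}(\theta):=\frac12\int_0^1\mathbb{E}_{X_t\sim p_t}\bigl[\|u_\theta(X_t,t)-u_t^*(X_t)\|_2^2\bigr]\mathrm{d}t$$ and the conditional flow-matching objective $$\mathcal{L}_{\mathrm{CFM}}(\theta):=\frac12\int_0^1\mathbb{E}_{X_1,\;X_t\sim p_t(\cdot\mid X_1)}\bigl[\|u_\theta(X_t,t)-u_t(X_t\mid X_1)\|_2^2\bigr]\mathrm{d}t$$ differ only by a constant independent of $\theta$. Equivalently, $$\mathcal{L}_{\mathrm{CFM}}(\theta)=\mathcal{L}_{\mathrm{FM}}(\theta)+C.$$
   Context: Generative-time convention: $t$ runs from $0$ (noise) to $1$ (data), and $X_1\sim p_1$ is a data sample in $\mathbb{R}^d$ with density $p_1$. The schedules $\alpha_t,\sigma_t$ satisfy $\alpha_0=0$, $\alpha_1=1$, $\sigma_0=1$, $\sigma_1=0$, and $\alpha_t\ge0$, $\sigma_t\ge0$ for all $t\in[0,1]$; a dot denotes $\mathrm{d}/\mathrm{d}t$. Conditional path: $p_t(x\mid x_1):=\mathcal{N}(x;\alpha_tx_1,\sigma_t^2I)$ (Gaussian density with mean $\alpha_tx_1$ and covariance $\sigma_t^2I$), the law of $X_t$ given $X_1=x_1$; marginal path: $p_t(x):=\int_{\mathbb{R}^d}p_t(x\mid x_1)p_1(x_1)\,\mathrm{d}x_1$. Conditional velocity: $u_t(x\mid x_1):=\left(\dot\alpha_t-\frac{\dot\sigma_t}{\sigma_t}\alpha_t\right)x_1+\frac{\dot\sigma_t}{\sigma_t}x$;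 marginal velocity: $u_t^*(x):=\mathbb{E}[u_t(x\mid X_1)\mid X_t=x]$. $u_\theta(x,t)\in\mathbb{R}^d$ is a model velocity field with parameter $\theta$. *)

(* Defs.v *)
From HB Require Import structures.
From mathcomp Require Import all_boot all_order all_algebra.
From mathcomp Require Import all_classical all_reals all_analysis.
Import Order.TTheory GRing.Theory Num.Theory.
Import numFieldNormedType.Exports.

Set Implicit Arguments.
Unset Strict Implicit.
Unset Printing Implicit Defensive.

Local Open Scope classical_set_scope.
Local Open Scope ring_scope.

(** Points of R^d are tuples [d.-tuple R]: the library equips this type with
    the product (= Borel) sigma-algebra, but has no Lebesgue measure on it.  It
    is built here by induction on d, as the image of the product measure on
    R * R^n under (a, v) |-> a :: v. *)

Section lebesgue_tuple.
Context {R : realType}.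

Definition cons_pair n (z : measurableTypeR R * n.-tuple R) : n.+1.-tuple R :=
  [the n.+1.-tuple R of z.1 :: z.2].

Lemma measurable_cons_pair n : measurable_fun [set: measurableTypeR R * n.-tuple R] (@cons_pair n).
Proof. exact: measurable_cons. Qed.

Section step.
Variables (n : nat) (mu : {sigma_finite_measure set (n.-tuple R) -> \bar R}).

Definition lebesgue_cons : set (n.+1.-tuple R) -> \bar R :=
  pushforward (lebesgue_measure \x mu)%E (@cons_pair n).

Let lebesgue_cons0 : lebesgue_cons set0 = 0%E.
Proof. by rewrite /lebesgue_cons /pushforward preimage_set0 measure0. Qed.

Let lebesgue_cons_ge0 A : (0 <= lebesgue_cons A)%E.
Proof. by rewrite /lebesgue_cons /pushforward; exact: measure_ge0. Qed.

Let lebesgue_cons_sigma_additive : semi_sigma_additive lebesgue_cons.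
Proof.
move=> F mF tF mUF; rewrite /lebesgue_cons /pushforward preimage_bigcup.
apply: measure_semi_sigma_additive.
- by move=> k; rewrite -[X in measurable X]setTI; exact: measurable_cons_pair.
- apply/trivIsetP => /= i j _ _ ij; rewrite -preimage_setI.
  by move/trivIsetP : tF => /(_ _ _ _ _ ij) ->//; rewrite preimage_set0.
- rewrite -preimage_bigcup -[X in measurable X]setTI.
  exact: measurable_cons_pair.
Qed.

HB.instance Definition _ := isMeasure.Build _ _ _ lebesgue_cons
  lebesgue_cons0 lebesgue_cons_ge0 lebesgue_cons_sigma_additive.

Let lebesgue_cons_sigma_finite : sigma_finite setT lebesgue_cons.
Proof.
have /sigma_finiteP[F [TF ndF Foo]] := sigma_finiteT (@lebesgue_measure R).
have /sigma_finiteP[G [TG ndG Goo]] := sigma_finiteT mu.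
pose H k : set (n.+1.-tuple R) :=
  ((fun v : n.+1.-tuple R => thead v) @^-1` F k) `&` ((fun v : n.+1.-tuple R => [tuple of behead v]) @^-1` G k).
exists H.
  rewrite predeqE => v; split => // _.
  have [k1 _ Fk1] : (\bigcup_k F k) (thead v) by rewrite -TF.
  have [k2 _ Gk2] : (\bigcup_k G k) [tuple of behead v] by rewrite -TG.
  exists (maxn k1 k2) => //; split => /=.
  - by move: Fk1; exact/subsetPset/ndF/leq_maxl.
  - by move: Gk2; exact/subsetPset/ndG/leq_maxr.
move=> k; have [mF Fkoo] := Foo k; have [mG Gkoo] := Goo k; split.
  apply: measurableI.
  - by rewrite -[X in measurable X]setTI; exact: (measurable_tnth ord0).
  - by rewrite -[X in measurable X]setTI; exact: measurable_behead.
rewrite /lebesgue_cons /pushforward.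
have -> : @cons_pair n @^-1` H k = F k `*` G k.
  have vE (a : R) (v : n.-tuple R) :
      [tuple of behead [the n.+1.-tuple R of a :: v]] = v by exact: val_inj.
  by apply/seteqP; split => -[a v]; rewrite /H /cons_pair /= vE.
by rewrite product_measure1E// lte_mul_pinfty// ge0_fin_numE.
Qed.

HB.instance Definition _ := Measure_isSigmaFinite.Build _ _ _ lebesgue_cons
  lebesgue_cons_sigma_finite.

End step.

Fixpoint lebesgue_tuple d : {sigma_finite_measure set (d.-tuple R) -> \bar R} :=
  match d with
  | 0 => \d_ ([tuple] : 0.-tuple R)
  | n.+1 => lebesgue_cons (lebesgue_tuple n)
  end.

End lebesgue_tuple.

Section flow_matching.
Context {R : realType} {d : nat}.
Implicit Types x y m : d.-tuple R.

Definition scale_tuple (a : R) x : d.-tuple R := [tuple a * tnth x i | i < d].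

Definition lin_comb (a : R) x (b : R) y : d.-tuple R :=
  [tuple a * tnth x i + b * tnth y i | i < d].

(** The squared Euclidean distance. *)
Definition sqdist x y : R := \sum_(i < d) (tnth x i - tnth y i) ^+ 2.

(** The density of N(m, s^2 I); only meaningful for s > 0.  For s = 0 and
    0 < d it is the zero function, since division by 0 is 0. *)
Definition gaussian_pdf m (s : R) x : R :=
  expR (- sqdist x m / (2 * s ^+ 2)) / Num.sqrt (2 * pi * s ^+ 2) ^+ d.

Definition is_density (p : d.-tuple R -> R) : Prop :=
  [/\ measurable_fun setT p, (forall x, 0 <= p x) &
      (\int[lebesgue_tuple d]_x (p x)%:E = 1)%E].

Definition expectation_density (p : d.-tuple R -> R) (f : d.-tuple R -> \bar R)
  : \bar R := (\int[lebesgue_tuple d]_x (f x * (p x)%:E))%E.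

(** E[g(Y) | X = x], when (X, Y) has joint density q: the integral of g against
    the conditional density y |-> q x y / \int q x y' dy'. *)
Definition cond_expectation (q : d.-tuple R -> d.-tuple R -> R)
    (g : d.-tuple R -> d.-tuple R) x : d.-tuple R :=
  let marginal := (\int[lebesgue_tuple d]_y q x y)%R in
  [tuple (\int[lebesgue_tuple d]_y (tnth (g y) i * (q x y / marginal)))%R
  | i < d].

Variables (alpha sigma : R -> R) (p1 : d.-tuple R -> R).

Definition cond_path (t : R) (x1 : d.-tuple R) x : R :=
  gaussian_pdf (scale_tuple (alpha t) x1) (sigma t) x.

Definition joint_path (t : R) x (x1 : d.-tuple R) : R :=
  cond_path t x1 x * p1 x1.

Definition marginal_path (t : R) x : R :=
  (\int[lebesgue_tuple d]_x1 (cond_path t x1 x * p1 x1))%R.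

Definition cond_velocity (t : R) (x1 : d.-tuple R) x : d.-tuple R :=
  lin_comb (derive1 alpha t - derive1 sigma t / sigma t * alpha t) x1
           (derive1 sigma t / sigma t) x.

Definition marginal_velocity (t : R) x : d.-tuple R :=
  cond_expectation (joint_path t) (fun x1 => cond_velocity t x1 x) x.

(** Both objectives are integrals of nonnegative functions, valued in
    [0, +oo]. *)
Definition loss_FM (v : d.-tuple R -> R -> d.-tuple R) : \bar R :=
  ((2^-1)%:E * \int[lebesgue_measure]_(t in `[0%R, 1%R])
     expectation_density (marginal_path t)
       (fun x => (sqdist (v x t) (marginal_velocity t x))%:E))%E.

Definition loss_CFM (v : d.-tuple R -> R -> d.-tuple R) : \bar R :=
  ((2^-1)%:E * \int[lebesgue_measure]_(t in `[0%R, 1%R])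
     expectation_density p1 (fun x1 =>
       expectation_density (cond_path t x1)
         (fun x => (sqdist (v x t) (cond_velocity t x1 x))%:E)))%E.

End flow_matching.

(* Main.v *)
(** For fixed t and x, let q(x1) = p_t(x | x1) p_1(x1), with mass p_t(x), and let
    u* be the mean of u_t(x | X1) under the normalized q.  The bias-variance
    identity
      int |v - u_t(x | x1)|^2 q dx1
        = |v - u*|^2 p_t(x) + int |u* - u_t(x | x1)|^2 q dx1
    holds in [0, +oo] for every v.  Taking v = u_theta(x, t) and integrating over
    x and t, with Tonelli to exchange x and x1, gives the theorem: C is half the
    integrated conditional variance of the velocity, which is bounded by
    L_CFM(theta) for every theta. *)

Require Import Defs.
From mathcomp Require Import all_boot all_order all_algebra.
From mathcomp Require Import all_classical all_reals all_analysis.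
From mathcomp Require Import measurable_realfun ring lra.
Import Order.TTheory GRing.Theory Num.Theory.
Import numFieldNormedType.Exports.

Local Open Scope classical_set_scope.
Local Open Scope ring_scope.

(** * Bias-variance identity for an unnormalised weight, scalar and vector case *)

Section bias_variance.
Context {d} {Y : measurableType d} {R : realType}.
Variables (mu : {measure set Y -> \bar R}) (k g : Y -> R).
Hypotheses (mk : measurable_fun setT k) (mg : measurable_fun setT g).
Hypothesis k_ge0 : forall y, 0 <= k y.
Hypothesis ik : mu.-integrable setT (EFin \o k).

Let M := (\int[mu]_y k y)%R.
Let m := (\int[mu]_y (g y * (k y / M)))%R.

Let ikE : (\int[mu]_y (k y)%:E = M%:E)%E.
Proof. by rewrite fineK// (integrable_fin_num measurableT ik). Qed.

Let msqr v : measurable_fun setT (fun y => (v - g y) ^+ 2 * k y).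
Proof.
apply: measurable_funM => //; apply: measurable_funX.
exact: measurable_funB.
Qed.

Let sqrM_ge0 v y : 0 <= (v - g y) ^+ 2 * k y.
Proof. by rewrite mulr_ge0// sqr_ge0. Qed.

(* (v - g)^2 <= 2 (v - w)^2 + 2 (w - g)^2 *)
Let integrable_center v w :
  mu.-integrable setT (fun y => ((w - g y) ^+ 2 * k y)%:E) ->
  mu.-integrable setT (fun y => ((v - g y) ^+ 2 * k y)%:E).
Proof.
move=> iw.
apply: (le_integrable measurableT (g := fun y =>
  ((2 * (v - w) ^+ 2)%:E * (k y)%:E + 2%:E * ((w - g y) ^+ 2 * k y)%:E)%E)).
- by apply/measurable_EFinP; exact: msqr.
- move=> y _; rewrite -!EFinM -EFinD !abse_EFin lee_fin.
  rewrite ger0_norm// ger0_norm; last first.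
    by rewrite addr_ge0// mulr_ge0// mulr_ge0// sqr_ge0.
  rewrite [X in _ <= _ + X]mulrA -mulrDl ler_wpM2r// -subr_ge0.
  rewrite (_ : _ - _ = ((v - w) - (w - g y)) ^+ 2) ?sqr_ge0//; ring.
- by apply: (integrableD measurableT); exact: integrableZl.
Qed.

(* If the second moment is infinite, [m] may be a junk value, but then both
   sides are +oo whatever [m] is. *)
Lemma integral_sqrB_mean v :
  (\int[mu]_y ((v - g y) ^+ 2 * k y)%:E =
   ((v - m) ^+ 2 * M)%:E + \int[mu]_y ((m - g y) ^+ 2 * k y)%:E)%E.
Proof.
(* By [integrable_center], a second moment finite about one centre is finite about every other, so
   which case holds does not depend on [v]. *)
have [iv|niv] := pselect
  (mu.-integrable setT (fun y => ((v - g y) ^+ 2 * k y)%:E)).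
  have im := integrable_center m v iv.
  have i0 := integrable_center 0 v iv.
  (* The first moment is finite because |g| <= 1 + g^2; [i0] controls the square. *)
  have ig : mu.-integrable setT (EFin \o (fun y => g y * k y)).
    have i1 := integrable_center 1 v iv.
    apply: (le_integrable measurableT (g := fun y =>
      ((k y)%:E + ((0 - g y) ^+ 2 * k y)%:E)%E)).
    - by apply/measurable_EFinP; exact: measurable_funM.
    - move=> y _; rewrite -EFinD !abse_EFin lee_fin normrM.
      rewrite [`|k y|]ger0_norm// [leRHS]ger0_norm; last first.
        by rewrite addr_ge0.
      rewrite -[X in _ <= X + _]mul1r -mulrDl ler_wpM2r// sub0r sqrrN.
      by rewrite -[in leRHS]real_normK ?num_real//; nra.
    - exact: (integrableD measurableT).
  have igE : (\int[mu]_y (g y * k y)%:E = (m * M)%:E)%E.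
    (* With zero mass, the quotient by [M] in [m] is 0 by convention. The identity survives: [k]
       vanishes almost everywhere, so both sides are 0. *)
    have [M0|M0] := eqVneq M 0.
      have k0 : ae_eq mu setT (EFin \o k) (cst 0%E).
        apply/(ae_eq_integral_abs mu measurableT); first exact/measurable_EFinP.
        rewrite -[RHS]/(0%R)%:E -M0 -ikE; apply: eq_integral => y _ /=.
        by rewrite ger0_norm.
      rewrite M0 mulr0; transitivity (\int[mu]_y (cst 0%E y : \bar R))%E; last first.
        by rewrite integral0.
      apply: ae_eq_integral => //.
      + by apply/measurable_EFinP; exact: measurable_funM.
      + by apply: filterS k0 => y /= /(_ I)[->] _; rewrite mulr0.
    have -> : m * M = (\int[mu]_y (g y * k y))%R.
      rewrite /m; under eq_Rintegral do rewrite mulrA.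
      by rewrite RintegralZr// mulfVK.
    by rewrite fineK// (integrable_fin_num measurableT ig).
  (* Only (m - g)^2 keeps the square of [g]. The rest is affine in [g], and the first moment [igE]
     turns it into (v^2 - m^2) M + 2 (m - v) m M = (v - m)^2 M. *)
  transitivity (\int[mu]_y (((v ^+ 2 - m ^+ 2)%:E * (k y)%:E
      + (2 * (m - v))%:E * (g y * k y)%:E) + ((m - g y) ^+ 2 * k y)%:E))%E.
    by apply: eq_integral => y _; rewrite -!EFinM -!EFinD; congr EFin; ring.
  rewrite integralD//; last first.
    by apply: (integrableD measurableT) => //; exact: integrableZl.
  congr +%E; rewrite integralD//; [|exact: integrableZl..].
  by rewrite !integralZl// ikE igE -!EFinM -EFinD; congr EFin; ring.
have infty w : ~ mu.-integrable setT (fun y => ((w - g y) ^+ 2 * k y)%:E) ->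
    (\int[mu]_y ((w - g y) ^+ 2 * k y)%:E = +oo)%E.
  move=> niw; apply/eqP; rewrite -leye_eq leNgt; apply/negP => iw; apply: niw.
  apply/integrableP; split; first exact/measurable_EFinP.
  by under eq_integral do rewrite abse_EFin ger0_norm//.
(* A finite moment about [m] would give one about [v]. Hence both moments are +oo, and the finite
   term on the right is absorbed. *)
rewrite !infty// => im; apply: niv; exact: integrable_center _ _ im.
Qed.

End bias_variance.

(** Both [sqdist] and [cond_expectation] act coordinatewise, so the scalar identity applies to each
    coordinate. The sums are exchanged with the integrals in [0, +oo], so a coordinate of infinite
    variance is allowed. *)
Lemma integral_sqdist_mean {R : realType} {n : nat}
    (q : n.-tuple R -> n.-tuple R -> R) (g : n.-tuple R -> n.-tuple R)
    (x v : n.-tuple R) :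
  measurable_fun setT (q x) -> measurable_fun setT g ->
  (forall y, 0 <= q x y) -> (lebesgue_tuple n).-integrable setT (EFin \o q x) ->
  (\int[lebesgue_tuple n]_y (sqdist v (g y) * q x y)%:E =
   (sqdist v (cond_expectation q g x) * (\int[lebesgue_tuple n]_y q x y)%R)%:E +
   \int[lebesgue_tuple n]_y (sqdist (cond_expectation q g x) (g y) * q x y)%:E)%E.
Proof.
move=> mq mg q0 iq.
have mgi i : measurable_fun setT (fun y => tnth (g y) i).
  by move/measurable_fun_tnthP : mg; exact.
have sumE w : (\int[lebesgue_tuple n]_y (sqdist w (g y) * q x y)%:E =
    \sum_(i < n) \int[lebesgue_tuple n]_y
      ((tnth w i - tnth (g y) i) ^+ 2 * q x y)%:E)%E.
  rewrite -ge0_integral_sum//.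
  - by apply: eq_integral => y _; rewrite sumEFin mulr_suml.
  - move=> i; apply/measurable_EFinP; apply: measurable_funM => //.
    by apply: measurable_funX; exact: measurable_funB.
  - by move=> i y _; rewrite lee_fin mulr_ge0// sqr_ge0.
rewrite !sumE /sqdist mulr_suml -sumEFin -big_split/=.
apply: eq_bigr => i _; rewrite tnth_mktuple.
exact: integral_sqrB_mean.
Qed.

(** * Measurability of parameter integrals, tuple operations and derivatives *)

Lemma measurable_fun_Rintegral {d1 d2} {S : measurableType d1}
    {Y : measurableType d2} {R : realType}
    (mu : {sigma_finite_measure set Y -> \bar R}) (f : S * Y -> R) :
  measurable_fun setT f ->
  measurable_fun setT (fun s => (\int[mu]_y f (s, y))%R).
Proof.
move=> mf; apply: measurableT_comp => //.
(* The sections may fail to be integrable: positive and negative parts are each measurable in [s] by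
   Tonelli, and [fine] sends infinite values to 0. *)
under eq_fun do rewrite integralE.
have mf' : measurable_fun setT (EFin \o f) by exact/measurable_EFinP.
apply: emeasurable_funB.
- apply: eq_measurable_fun (measurable_fun_fubini_tonelli_F (m2 := mu) _
    (measurable_funepos mf') _) => // s _.
  by apply: eq_integral => y _; rewrite !funeposE.
- apply: eq_measurable_fun (measurable_fun_fubini_tonelli_F (m2 := mu) _
    (measurable_funeneg mf') _) => // s _.
  by apply: eq_integral => y _; rewrite !funenegE.
Qed.

(** Inversion is continuous on the open complement of 0, and the single point 0, where its value is
    0 by convention, is treated apart. *)
Lemma measurable_invr {R : realType} : measurable_fun [set: R] (@GRing.inv R).
Proof.
have -> : [set: R] = [set 0] `|` ~` [set 0] by rewrite setUv.
apply/measurable_funU => //; first exact: measurableC.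
split; first exact: measurable_fun_set1.
apply: open_continuous_measurable_fun; first exact/closed_openC/closed_eq.
by move=> x; rewrite inE/= => /eqP x0; exact: inv_continuous.
Qed.

Section measurable_tuple.
Context {d} {S : measurableType d} {R : realType} {n : nat}.
Implicit Types x y : S -> n.-tuple R.

Lemma measurable_fun_tnth x i :
  measurable_fun setT x -> measurable_fun setT (fun s => tnth (x s) i).
Proof. by move/measurable_fun_tnthP; exact. Qed.

Lemma measurable_fun_mktuple (f : 'I_n -> S -> R) :
  (forall i, measurable_fun setT (f i)) ->
  measurable_fun setT (fun s => [tuple f i s | i < n]).
Proof.
move=> mf; apply/measurable_fun_tnthP => i.
by apply: eq_measurable_fun (mf i) => s _; rewrite /= tnth_mktuple.
Qed.

Lemma measurable_fun_sqdist x y :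
  measurable_fun setT x -> measurable_fun setT y ->
  measurable_fun setT (fun s => sqdist (x s) (y s)).
Proof.
move=> mx my; apply: measurable_sum => i; apply: measurable_funX.
by apply: measurable_funB; exact: measurable_fun_tnth.
Qed.

Lemma measurable_fun_scale_tuple (a : S -> R) x :
  measurable_fun setT a -> measurable_fun setT x ->
  measurable_fun setT (fun s => scale_tuple (a s) (x s)).
Proof.
move=> ma mx; apply: measurable_fun_mktuple => i.
by apply: measurable_funM => //; exact: measurable_fun_tnth.
Qed.

Lemma measurable_fun_lin_comb (a b : S -> R) x y :
  measurable_fun setT a -> measurable_fun setT x ->
  measurable_fun setT b -> measurable_fun setT y ->
  measurable_fun setT (fun s => lin_comb (a s) (x s) (b s) (y s)).
Proof.
move=> ma mx mb my; apply: measurable_fun_mktuple => i.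
by apply: measurable_funD; apply: measurable_funM => //;
  exact: measurable_fun_tnth.
Qed.

Lemma measurable_fun_gaussian_pdf (a : S -> R) x y :
  measurable_fun setT a -> measurable_fun setT x -> measurable_fun setT y ->
  measurable_fun setT (fun s => gaussian_pdf (y s) (a s) (x s)).
Proof.
move=> ma mx my.
have ma2 c : measurable_fun setT (fun s => c * a s ^+ 2).
  by apply: measurable_funM => //; exact: measurable_funX.
have msqrt : measurable_fun [set: R] (@Num.sqrt R).
  by apply: continuous_measurable_fun; exact: sqrt_continuous.
apply: measurable_funM; first apply: measurableT_comp => //.
  apply: measurable_funM.
    by apply: measurableT_comp => //; exact: measurable_fun_sqdist.
  by apply: (measurableT_comp measurable_invr); exact: ma2.
apply: (measurableT_comp measurable_invr); apply: measurable_funX.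
apply: (measurableT_comp msqrt); exact: ma2.
Qed.

End measurable_tuple.

(** The derivative is the pointwise limit of the difference quotients with steps 1/(n+1), each of
    them measurable. *)
Lemma measurable_derive1 {R : realType} (f : R -> R) (a b : R) :
  (forall t, a < t < b -> derivable f t 1) -> measurable_fun `]a, b[ (derive1 f).
Proof.
move=> df.
have mf : measurable_fun `]a, b[ f.
  apply: subspace_continuous_measurable_fun => //.
  by apply: derivable_within_continuous => t; rewrite in_itv/=; exact: df.
(* The shifted point may leave the interval, so the quotients are formed with the extension of [f]
   by 0, measurable on the whole line. For fixed [t] the shifted point lies in the interval for
   large [n], where [g] is [f]. *)
pose g := f \_ `]a, b[.
have mg : measurable_fun setT g by apply/(measurable_restrictT f) => //.
pose h n (t : R) : R := (harmonic n)^-1 * (g (harmonic n + t) - g t).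
apply: (measurable_fun_cvg (h := h)) => [n|t abt].
  apply: measurable_funTS; apply: measurable_funM => //.
  apply: measurable_funB => //; apply: measurableT_comp => //.
  exact: measurable_funD.
have gE s : s \in `]a, b[%R -> g s = f s by move=> abs; rewrite /g patchE mem_set.
have dft : (h^-1 *: (f (h + t) - f t) @[h --> 0^'] --> derive1 f t).
  have := df t; rewrite /derivable /derive1.
  rewrite (_ : (fun h => h^-1 *: _) = (fun h => h^-1 *: (f (h + t) - f t))).
    by apply; move: abt; rewrite /= in_itv.
  by apply/funext => h'; rewrite /= /shift -[h' *: 1]/(h' * 1) mulr1.
apply: cvg_trans; last first.
  apply: (cvgr_dnbhsP _ _ _).1 dft harmonic _; split; last exact: cvg_harmonic.
  by move=> n; rewrite gt_eqF// invr_gt0 ltr0n.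
apply: near_eq_cvg; near=> n; rewrite /h !gE//.
near: n.
have ct : harmonic n + t @[n --> \oo] --> t.
  rewrite -[X in _ --> X]add0r.
  by apply: cvgD; [exact: cvg_harmonic|exact: cvg_cst].
exact: (ct _ (near_in_itvoo abt)).
Unshelve. all: by end_near. Qed.

(** * Least-squares regression with a parameter: excess risk and Bayes risk *)

Section conditional_regression.
Context {d} {S : measurableType d} {R : realType} {n : nat}.
Local Notation X := (n.-tuple R).
Variables (q : S -> X -> X -> R) (g : S -> X -> X -> X).
Hypothesis mq : measurable_fun setT (fun w : S * X * X => q w.1.1 w.1.2 w.2).
Hypothesis mg : measurable_fun setT (fun w : S * X * X => g w.1.1 w.1.2 w.2).
Hypothesis q_ge0 : forall s x y, 0 <= q s x y.

Let mean (z : S * X) : X := cond_expectation (q z.1) (g z.1 z.2) z.2.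
Let marginal (z : S * X) : R := (\int[lebesgue_tuple n]_y q z.1 z.2 y)%R.

Lemma measurable_marginal : measurable_fun setT marginal.
Proof. exact: (measurable_fun_Rintegral (lebesgue_tuple n) _ mq). Qed.

Lemma measurable_cond_expectation : measurable_fun setT mean.
Proof.
apply: measurable_fun_mktuple => i.
apply: (measurable_fun_Rintegral (lebesgue_tuple n)
  (fun w => tnth (g w.1.1 w.1.2 w.2) i * (q w.1.1 w.1.2 w.2 / marginal w.1))).
apply: measurable_funM; first exact: measurable_fun_tnth.
apply: measurable_funM => //; apply: (measurableT_comp measurable_invr).
exact: measurableT_comp measurable_marginal measurable_fst.
Qed.

(** This and [measurable_fun_bayes_risk] allow the integral over the parameter to be split into
    two. *)
Lemma measurable_fun_excess_risk (v : S * X -> X) : measurable_fun setT v ->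
  measurable_fun setT (fun s =>
    \int[lebesgue_tuple n]_x (sqdist (v (s, x)) (mean (s, x)) * marginal (s, x))%:E)%E.
Proof.
move=> mv.
have mf : measurable_fun setT
    (fun z => (sqdist (v z) (mean z) * marginal z)%:E).
  apply/measurable_EFinP; apply: measurable_funM.
    exact: measurable_fun_sqdist mv measurable_cond_expectation.
  exact: measurable_marginal.
apply: (measurable_fun_fubini_tonelli_F (m2 := lebesgue_tuple n) _ mf) => z.
rewrite lee_fin mulr_ge0//; last exact: Rintegral_ge0.
by apply: sumr_ge0 => i _; exact: sqr_ge0.
Qed.

Let risk (v : S * X -> X) (z : S * X) : \bar R :=
  (\int[lebesgue_tuple n]_y (sqdist (v z) (g z.1 z.2 y) * q z.1 z.2 y)%:E)%E.

Let mrisk_integrand (v : S * X -> X) : measurable_fun setT v ->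
  measurable_fun setT (fun w : S * X * X =>
    (sqdist (v w.1) (g w.1.1 w.1.2 w.2) * q w.1.1 w.1.2 w.2)%:E).
Proof.
move=> mv; apply/measurable_EFinP; apply: measurable_funM => //.
by apply: measurable_fun_sqdist => //; exact: measurableT_comp mv measurable_fst.
Qed.

Let risk_integrand_ge0 (v : S * X -> X) w :
  (0 <= (sqdist (v w.1) (g w.1.1 w.1.2 w.2) * q w.1.1 w.1.2 w.2)%:E)%E.
Proof.
by rewrite lee_fin mulr_ge0//; apply: sumr_ge0 => i _; exact: sqr_ge0.
Qed.

Let measurable_risk v : measurable_fun setT v -> measurable_fun setT (risk v).
Proof.
move=> mv; have mf := mrisk_integrand _ mv.
exact: (measurable_fun_fubini_tonelli_F (m2 := lebesgue_tuple n) _ mf).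
Qed.

Lemma measurable_fun_bayes_risk : measurable_fun setT (fun s =>
  \int[lebesgue_tuple n]_x \int[lebesgue_tuple n]_y
    (sqdist (mean (s, x)) (g s x y) * q s x y)%:E)%E.
Proof.
have mf := measurable_risk _ measurable_cond_expectation.
apply: (measurable_fun_fubini_tonelli_F (m2 := lebesgue_tuple n) _ mf) => z.
by apply: integral_ge0 => y _; exact: (risk_integrand_ge0 mean (z, y)).
Qed.

(** The left side integrates over [x] first, as the conditional objective does. Tonelli brings [y]
    inside, and [integral_sqdist_mean] then applies at each fixed [x]. The last term is free of
    [v]. *)
Lemma risk_decomposition s (v : S * X -> X) : measurable_fun setT v ->
  (forall x, (lebesgue_tuple n).-integrable setT (EFin \o q s x)) ->
  (\int[lebesgue_tuple n]_y \int[lebesgue_tuple n]_x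
     (sqdist (v (s, x)) (g s x y) * q s x y)%:E =
   \int[lebesgue_tuple n]_x (sqdist (v (s, x)) (mean (s, x)) * marginal (s, x))%:E +
   \int[lebesgue_tuple n]_x \int[lebesgue_tuple n]_y
     (sqdist (mean (s, x)) (g s x y) * q s x y)%:E)%E.
Proof.
move=> mv iq.
have msxy : measurable_fun setT (fun w : X * X => (s, w.1, w.2)).
  apply: measurable_fun_pair => //.
  by apply: measurable_fun_pair => //; exact: measurable_cst.
have msx : measurable_fun setT (fun x : X => (s, x)) by exact: pair1_measurable.
rewrite -(fubini_tonelli (m1 := lebesgue_tuple n) (m2 := lebesgue_tuple n)
    (fun w => (sqdist (v (s, w.1)) (g s w.1 w.2) * q s w.1 w.2)%:E)); last 2 first.
- exact: measurableT_comp (mrisk_integrand _ mv) msxy.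
- by move=> w; exact: (risk_integrand_ge0 v (s, w.1, w.2)).
rewrite -ge0_integralD//.
- apply: eq_integral => x _ /=; rewrite integral_sqdist_mean//.
  + exact: measurableT_comp mq (pair1_measurable (s, x)).
  + exact: measurableT_comp mg (pair1_measurable (s, x)).
- move=> x _; rewrite lee_fin mulr_ge0//; last exact: Rintegral_ge0.
  by apply: sumr_ge0 => i _; exact: sqr_ge0.
- apply/measurable_EFinP; apply: measurable_funM.
    by apply: measurable_fun_sqdist; [exact: measurableT_comp mv msx
      |exact: measurableT_comp measurable_cond_expectation msx].
  exact: measurableT_comp measurable_marginal msx.
- by move=> x _; apply: integral_ge0 => y _; exact: (risk_integrand_ge0 mean (s, x, y)).
- exact: measurableT_comp (measurable_risk _ measurable_cond_expectation) msx.
Qed.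

End conditional_regression.

(** * The joint density of the Gaussian path *)

Section joint_path.
Context {R : realType} {n : nat}.
Variables (alpha sigma : R -> R) (p1 : n.-tuple R -> R).
Hypothesis p1_density : is_density p1.

Lemma gaussian_pdf_ge0 (m x : n.-tuple R) s : 0 <= gaussian_pdf m s x.
Proof. by rewrite /gaussian_pdf divr_ge0 ?expR_ge0// exprn_ge0// sqrtr_ge0. Qed.

Lemma joint_path_ge0 t x x1 : 0 <= joint_path alpha sigma p1 t x x1.
Proof.
by case: p1_density => _ p1_ge0 _; rewrite mulr_ge0// gaussian_pdf_ge0.
Qed.

Lemma measurable_joint_path :
  measurable_fun setT alpha -> measurable_fun setT sigma ->
  measurable_fun setT (fun w : R * n.-tuple R * n.-tuple R =>
    joint_path alpha sigma p1 w.1.1 w.1.2 w.2).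
Proof.
move=> ma ms; case: p1_density => mp1 _ _.
have mt : measurable_fun setT (fun w : R * n.-tuple R * n.-tuple R => w.1.1).
  exact: measurableT_comp measurable_fst measurable_fst.
have mx : measurable_fun setT (fun w : R * n.-tuple R * n.-tuple R => w.1.2).
  exact: measurableT_comp measurable_snd measurable_fst.
apply: measurable_funM; last exact: measurableT_comp mp1 measurable_snd.
apply: measurable_fun_gaussian_pdf => //; first exact: measurableT_comp ms mt.
apply: measurable_fun_scale_tuple => //; exact: measurableT_comp ma mt.
Qed.

Lemma integrable_joint_path t x :
  (lebesgue_tuple n).-integrable setT (EFin \o joint_path alpha sigma p1 t x).
Proof.
case: p1_density => mp1 p1_ge0 ip1.
have mj : measurable_fun setT (joint_path alpha sigma p1 t x).
  apply: measurable_funM => //; apply: measurable_fun_gaussian_pdf => //.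
  exact: measurable_fun_scale_tuple.
(* The peak value of the Gaussian: the exponential is at most 1. The bound also holds at
   [sigma t = 0], with the conventional inverse. *)
pose c : R := (Num.sqrt (2 * pi * sigma t ^+ 2) ^+ n)^-1.
apply: (le_integrable measurableT (g := fun x1 => (c%:E * (p1 x1)%:E)%E)).
- exact/measurable_EFinP.
- move=> y _; rewrite -EFinM !abse_EFin lee_fin.
  have c0 : 0 <= c by rewrite invr_ge0 exprn_ge0// sqrtr_ge0.
  rewrite ger0_norm ?joint_path_ge0// ger0_norm ?mulr_ge0//.
  rewrite ler_wpM2r// -[leRHS]mul1r ler_wpM2r//.
  rewrite -expR0 ler_expR mulNr oppr_le0 divr_ge0//.
    by apply: sumr_ge0 => i _; exact: sqr_ge0.
  by rewrite mulr_ge0// sqr_ge0.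
- apply: integrableZl => //; apply/integrableP; split; first exact/measurable_EFinP.
  by under eq_integral do rewrite abse_EFin ger0_norm//; rewrite ip1 ltry.
Qed.

(** Moves the weight [p1 x1] under the inner integral, which gives the nested expectation of
    [loss_CFM] the shape of the left side of [risk_decomposition]. *)
Lemma expectation_cond_path (t : R) (x1 : n.-tuple R) (f : n.-tuple R -> R) :
  measurable_fun setT f -> (forall x, 0 <= f x) ->
  (expectation_density (cond_path alpha sigma t x1) (fun x => (f x)%:E)
     * (p1 x1)%:E =
   \int[lebesgue_tuple n]_x (f x * joint_path alpha sigma p1 t x x1)%:E)%E.
Proof.
move=> mf f0; case: p1_density => _ p1_ge0 _.
rewrite -ge0_integralZr//.
- by apply: eq_integral => x _; rewrite -!EFinM /joint_path mulrA.
- apply/measurable_EFinP; apply: measurable_funM => //.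
  exact: measurable_fun_gaussian_pdf.
- by move=> x _; rewrite -EFinM lee_fin mulr_ge0// gaussian_pdf_ge0.
- by rewrite lee_fin.
Qed.

End joint_path.

(** * Integration over time and comparison of the two objectives *)

Theorem theorem8p3 (R : realType) (d : nat) (alpha sigma : R -> R)
  (p1 : d.-tuple R -> R) (Theta : Type)
  (u : Theta -> d.-tuple R -> R -> d.-tuple R)
  (alpha0 : alpha 0 = 0) (alpha1 : alpha 1 = 1)
  (sigma0 : sigma 0 = 1) (sigma1 : sigma 1 = 0)
  (alpha_ge0 : forall t, 0 <= t <= 1 -> 0 <= alpha t)
  (sigma_ge0 : forall t, 0 <= t <= 1 -> 0 <= sigma t)
  (alpha_derivable : forall t, 0 < t < 1 -> derivable alpha t 1)
  (sigma_derivable : forall t, 0 < t < 1 -> derivable sigma t 1)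
  (p1_density : is_density p1)
  (u_measurable : forall theta,
     measurable_fun ([set: d.-tuple R] `*` [set t : R | 0 <= t <= 1])
       (fun z : d.-tuple R * R => u theta z.1 z.2)) :
  exists C : \bar R,
    (forall theta, loss_CFM alpha sigma p1 (u theta)
                   = (loss_FM alpha sigma p1 (u theta) + C)%E) /\
    ((exists theta, (loss_CFM alpha sigma p1 (u theta) < +oo)%E) ->
     C \is a fin_num).
Proof.
pose I01 : set R := `[0, 1]%classic.
have mI01 : measurable I01 by exact: measurable_itv.
(* The two endpoints do not affect measurability. Derivatives are controlled only on the open
   interval and may be default values at 0 and 1. *)
have m_oo (f : R -> R) : measurable_fun (`]0, 1[%classic : set R) f ->
    measurable_fun setT (f \_ I01).
  move=> mf; apply/(measurable_restrictT f mI01); exact: measurable_fun_itv_cc mf.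
have m_schedule (f : R -> R) : (forall t, 0 < t < 1 -> derivable f t 1) ->
    measurable_fun (`]0, 1[%classic : set R) f.
  move=> df; apply: subspace_continuous_measurable_fun => //.
  by apply: derivable_within_continuous => t; rewrite in_itv/=; exact: df.
(* The coefficients of [x] and of [x1] in [cond_velocity]; the quotient is 0 where [sigma t] is
   0. *)
pose k2 t : R := derive1 sigma t / sigma t.
pose k1 t : R := derive1 alpha t - k2 t * alpha t.
have mk2 : measurable_fun (`]0, 1[%classic : set R) k2.
  apply: measurable_funM; first exact: measurable_derive1.
  by apply: (measurableT_comp measurable_invr); exact: m_schedule.
have mk1 : measurable_fun (`]0, 1[%classic : set R) k1.
  apply: measurable_funB; first exact: measurable_derive1.
  by apply: measurable_funM => //; exact: m_schedule.
(* Tonelli needs integrands measurable on all of R, whereas the schedules are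
   only controlled on [0, 1]: cut them off outside. *)
pose a := alpha \_ I01; pose s := sigma \_ I01.
pose c1 := k1 \_ I01; pose c2 := k2 \_ I01.
(* Regression instance: the parameter is time, [q] the unnormalised weight, [g] the conditional
   velocity as target. *)
pose q := joint_path a s p1.
pose g (t : R) (x y : d.-tuple R) : d.-tuple R := lin_comb (c1 t) y (c2 t) x.
have mt : measurable_fun setT (fun w : R * d.-tuple R * d.-tuple R => w.1.1).
  exact: measurableT_comp measurable_fst measurable_fst.
have mx : measurable_fun setT (fun w : R * d.-tuple R * d.-tuple R => w.1.2).
  exact: measurableT_comp measurable_snd measurable_fst.
have mq : measurable_fun setT
    (fun w : R * d.-tuple R * d.-tuple R => q w.1.1 w.1.2 w.2).
  by apply: measurable_joint_path => //; apply: m_oo; exact: m_schedule.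
have mg : measurable_fun setT
    (fun w : R * d.-tuple R * d.-tuple R => g w.1.1 w.1.2 w.2).
  apply: measurable_fun_lin_comb => //.
  - exact: measurableT_comp (m_oo _ mk1) mt.
  - exact: measurableT_comp (m_oo _ mk2) mt.
have q0 t x y : 0 <= q t x y by exact: joint_path_ge0.
pose mean (z : R * d.-tuple R) : d.-tuple R :=
  cond_expectation (q z.1) (g z.1 z.2) z.2.
pose marginal (z : R * d.-tuple R) : R :=
  (\int[lebesgue_tuple d]_y q z.1 z.2 y)%R.
pose D := [set: d.-tuple R] `*` [set t : R | 0 <= t <= 1].
have DI : [set t : R | 0 <= t <= 1] = I01.
  by apply/seteqP; split => t; rewrite /I01/= in_itv.
have mD : measurable D by rewrite /D DI; exact: measurableX.
(* The model is measurable only on [D], so it is cut off as well; the swap puts time first, as the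
   parameter. *)
pose v theta (z : R * d.-tuple R) : d.-tuple R :=
  ((fun z : d.-tuple R * R => u theta z.1 z.2) \_ D) (z.2, z.1).
have mv theta : measurable_fun setT (v theta).
  have mu := (measurable_restrictT _ mD).1 (u_measurable theta).
  exact: measurableT_comp mu (@measurable_swap _ _ _ _).
(* This equation and the next four say that the cut-off objects agree with the original ones on
   [0, 1], the only times over which the objectives integrate. *)
have vE theta t x : t \in I01 -> v theta (t, x) = u theta x t.
  by move=> tI; rewrite /v patchE mem_set//= /D DI; split => //=; rewrite -inE.
have qE t : t \in I01 -> joint_path alpha sigma p1 t = q t.
  move=> tI; apply/funext => x; apply/funext => y.
  by rewrite /q /joint_path /cond_path /a /s !patchE tI.
have gE t x y : t \in I01 -> cond_velocity alpha sigma t y x = g t x y.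
  by move=> tI; rewrite /g /c1 /c2 !patchE tI.
have meanE t x : t \in I01 -> marginal_velocity alpha sigma p1 t x = mean (t, x).
  move=> tI; rewrite /marginal_velocity qE//.
  by congr cond_expectation; apply/funext => y; exact: gE.
have marginalE t x : t \in I01 -> marginal_path alpha sigma p1 t x = marginal (t, x).
  by move=> tI; rewrite /marginal -(qE t).
pose excess theta t := (\int[lebesgue_tuple d]_x
  (sqdist (v theta (t, x)) (mean (t, x)) * marginal (t, x))%:E)%E.
pose bayes t := (\int[lebesgue_tuple d]_x \int[lebesgue_tuple d]_y
    (sqdist (mean (t, x)) (g t x y) * q t x y)%:E)%E.
have sqdist_ge0 (x y : d.-tuple R) : 0 <= sqdist x y.
  by apply: sumr_ge0 => i _; exact: sqr_ge0.
have excess_ge0 theta t : (0 <= excess theta t)%E.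
  by apply: integral_ge0 => x _; rewrite lee_fin mulr_ge0//; exact: Rintegral_ge0.
have bayes_ge0 t : (0 <= bayes t)%E.
  apply: integral_ge0 => x _; apply: integral_ge0 => y _.
  by rewrite lee_fin mulr_ge0.
have FME theta : loss_FM alpha sigma p1 (u theta) =
    ((2^-1)%:E * \int[lebesgue_measure]_(t in I01) excess theta t)%E.
  rewrite /loss_FM; apply: (congr1 (mule _)); apply: eq_integral => t tI.
  apply: eq_integral => x _.
  by rewrite -EFinM -(vE _ _ _ tI) (meanE _ _ tI) (marginalE _ _ tI).
have CFME theta : loss_CFM alpha sigma p1 (u theta) =
    ((2^-1)%:E * \int[lebesgue_measure]_(t in I01) (excess theta t + bayes t))%E.
  rewrite /loss_CFM; apply: (congr1 (mule _)); apply: eq_integral => t tI.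
  rewrite /excess /bayes /mean /marginal.
  (* Read from right to left, the decomposition restores the double integral with [x] inside, to be
     matched with the nested expectations. *)
  rewrite -(risk_decomposition q g mq mg q0)//; last first.
    by move=> x; exact: integrable_joint_path.
  apply: eq_integral => y _; rewrite expectation_cond_path//.
  - apply: eq_integral => x _.
    by rewrite (qE _ tI) -(vE _ _ _ tI) (gE _ _ _ tI).
  - have -> :
        (fun x => sqdist (u theta x t) (cond_velocity alpha sigma t y x)) =
        (fun x => sqdist (v theta (t, x)) (g t x y)).
      apply/funext => x.
      by rewrite -(vE _ _ _ tI) (gE _ _ _ tI).
    apply: measurable_fun_sqdist.
    + exact: measurableT_comp (mv theta) (pair1_measurable t).
    + exact: measurable_fun_lin_comb.
exists ((2^-1)%:E * \int[lebesgue_measure]_(t in I01) bayes t)%E.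
have half_ge0 : (0 <= (2^-1)%:E :> \bar R)%E by rewrite lee_fin.
have sumE theta : loss_CFM alpha sigma p1 (u theta) =
    (loss_FM alpha sigma p1 (u theta) +
     (2^-1)%:E * \int[lebesgue_measure]_(t in I01) bayes t)%E.
  rewrite CFME FME -ge0_muleDr//; [|exact: integral_ge0..].
  (* Additivity for nonnegative functions holds in [0, +oo], so infinite losses are covered; what
     remains is measurability in time. *)
  rewrite ge0_integralD//.
  - by apply: measurable_funTS; exact: (measurable_fun_excess_risk _ _ mq mg q0 _ (mv theta)).
  - by apply: measurable_funTS; exact: (measurable_fun_bayes_risk _ _ mq mg q0).
split=> // -[theta]; rewrite sumE => foo.
rewrite ge0_fin_numE; last by rewrite mule_ge0// integral_ge0.
apply: le_lt_trans foo; rewrite leeDr// FME mule_ge0// integral_ge0//.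
Qed.
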